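(* Let $(X,\mathcal{U})$ be a $T_0$ bicomplete quasi-uniform space generated by a family $\mathcal{D}=\{d_\alpha\}_{\alpha\in A}$ of quasi-pseudometrics, and let $T\colon X\to X$ be a $\mathcal{D}$-Boyd--Wong contraction. Then $T$ has a unique fixed point $x^*\in X$, and for every $x_0\in X$ the iterates $T^n x_0$ converge to $x^*$ in $\mathcal{U}^s$.
   Context: $X$ is a non-empty set. A quasi-uniformity on $X$ is a filter $\mathcal{U}$ on $X\times X$ such that every $U\in\mathcal{U}$ contains the diagonal $\Delta_X$ and for every $U\in\mathcal{U}$ there is $V\in\mathcal{U}$ with $V\circ V\subseteq U$, where $V\circ V=\{(x,z):\exists y,\ (x,y)\in V,\ (y,z)\in V\}$. The pair $(X,\mathcal{U})$ is a quasi-uniform space. Put $U^{-1}=\{(x,y):(y,x)\in U\}$. The symmetrisation $\mathcal{U}^s$ is the uniformity generated by the entourages $U\cap U^{-1}$, $U\in\mathcal{U}$; convergence in $\mathcal{U}^s$ is convergence in its uniform topology. $\mathcal{U}$ is $T_0$ if the preorder $\bigcap\mathcal{U}:=\bigcap_{U\in\mathcal{U}}U$ is antisymmetric. $(X,\mathcal{U})$ is bicomplete if the uniform space $(X,\mathcal{U}^s)$ is complete (every net that is Cauchy for $\mathcal{U}^s$ converges in $\mathcal{U}^s$). A quasi-pseudometric on $X$ is a function $d\colon X\times X\to[0,\infty)$ with $d(x,x)=0$ and $d(x,z)\le d(x,y)+d(y,z)$. A family $\mathcal{D}$ of quasi-pseudometrics generates the quasi-uniformity having as subbase the sets $\{(x,y):d(x,y)<\varepsilon\}$,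 $d\in\mathcal{D}$, $\varepsilon>0$. A self-map $T\colon X\to X$ is a $\mathcal{D}$-Boyd--Wong contraction if there is a family $\{\varphi_\alpha\}_{\alpha\in A}$ of functions $\varphi_\alpha\colon[0,\infty)\to[0,\infty)$ such that each $\varphi_\alpha$ is nondecreasing, right upper semicontinuous (that is, $\limsup_{s\to t^+}\varphi_\alpha(s)\le\varphi_\alpha(t)$ for every $t\ge 0$), satisfies $\varphi_\alpha(0)=0$ and $\varphi_\alpha(t)<t$ for every $t>0$, and such that for every $\alpha\in A$ and all $x,y\in X$, $d_\alpha(Tx,Ty)\le\varphi_\alpha(d_\alpha(x,y))$ and $d_\alpha(Ty,Tx)\le\varphi_\alpha(d_\alpha(y,x))$. *)

(* Defs.v *)
From HB Require Import structures.
From mathcomp Require Import all_boot all_order all_algebra.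
From mathcomp Require Import all_classical all_reals all_analysis.

Set Implicit Arguments.
Unset Strict Implicit.
Unset Printing Implicit Defensive.

Import Order.TTheory GRing.Theory Num.Theory.
Import numFieldNormedType.Exports.

Local Open Scope classical_set_scope.
Local Open Scope ring_scope.

Local Open Scope relation_scope.

Record quasiUniformity (X : Type) := QuasiUniformity {
  qentourage :> set_system (X * X);
  qentourage_filter : Filter qentourage;
  qentourage_diagonal : forall V, qentourage V -> diagonal `<=` V;
  qentourage_split :
    forall V, qentourage V -> exists2 W, qentourage W & W \; W `<=` V
}.

Definition qu_T0 (X : Type) (U : quasiUniformity X) : Prop :=
  let le := \bigcap_(V in qentourage U) V in
  forall x y, le (x, y) -> le (y, x) -> x = y.

(* An alias of X, so that the uniform structure (hence the topology) inferred
   on [symmetrised U] is the symmetrisation of U. *)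
Definition symmetrised (X : Type) (U : quasiUniformity X) : Type := X.

Section symmetrisation.
Variables (X : Type) (U : quasiUniformity X).

Definition symm_entourage : set_system (X * X) :=
  filter_from (qentourage U) (fun V => V `&` V^-1).

Lemma symm_entourage_filter : Filter symm_entourage.
Proof.
have FU := qentourage_filter U; apply: filter_from_filter.
  by exists setT; exact: filterT.
move=> V W UV UW; exists (V `&` W); first exact: filterI.
by move=> [x y] [[? ?] [? ?]].
Qed.

Lemma symm_entourage_diagonal V : symm_entourage V -> diagonal `<=` V.
Proof.
move=> [W UW WV] [x y] /= xy; apply: WV.
by split; apply: (qentourage_diagonal UW).
Qed.

Lemma symm_entourage_inv V : symm_entourage V -> symm_entourage V^-1.
Proof. by move=> [W UW WV]; exists W => // -[x y] [? ?]; exact: WV. Qed.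

Lemma symm_entourage_split V : symm_entourage V ->
  exists2 W, symm_entourage W & W \; W `<=` V.
Proof.
move=> [W UW WV]; have [Y UY YW] := qentourage_split UW.
exists (Y `&` Y^-1); first by exists Y.
move=> [x z] /= [y [/= xy yx] [/= yz zy]]; apply: WV; split => /=.
  by apply: YW; exists y.
by apply: YW; exists y.
Qed.

HB.instance Definition _ := gen_eqMixin (symmetrised U).
HB.instance Definition _ := gen_choiceMixin (symmetrised U).
HB.instance Definition _ := isUniform.Build (symmetrised U)
  symm_entourage_filter symm_entourage_diagonal
  symm_entourage_inv symm_entourage_split.

End symmetrisation.

Local Close Scope relation_scope.

Definition directed (I : Type) (le : I -> I -> Prop) : Prop :=
  [/\ inhabited I,
      forall i, le i i,
      forall i j k, le i j -> le j k -> le i k &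
      forall i j, exists2 k, le i k & le j k].

(* The filter of sets containing a tail of the directed set: a net x converges
   to p iff x @ tails le --> p, and is Cauchy iff its image filter is. *)
Definition tails (I : Type) (le : I -> I -> Prop) : set_system I :=
  [set P | exists i, forall j, le i j -> P j].

Definition bicomplete (X : Type) (U : quasiUniformity X) : Prop :=
  forall (I : Type) (le : I -> I -> Prop), directed le ->
  forall x : I -> symmetrised U,
    cauchy (x @ tails le) -> exists p : symmetrised U, x @ tails le --> p.

Definition quasi_pseudometric (R : realType) (X : Type) (d : X -> X -> R) :=
  [/\ forall x y, 0 <= d x y,
      forall x, d x x = 0 &
      forall x y z, d x z <= d x y + d y z].

Definition qpm_subbase (R : realType) (X A : Type) (d : A -> X -> X -> R) :
    set_system (X * X) :=
  [set V | exists a eps, 0 < eps /\ V = [set xy | d a xy.1 xy.2 < eps]].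

Definition generated_by (R : realType) (X A : Type) (U : quasiUniformity X)
    (d : A -> X -> X -> R) : Prop :=
  qentourage U = filter_from (finI_from (qpm_subbase d) id) id.

(* A function [0, +oo[ -> [0, +oo[ is represented by phi : R -> R, of which only
   the values on [0, +oo[ are constrained. *)
Record comparison_function (R : realType) (phi : R -> R) : Prop := {
  comparison_ge0 : forall t, 0 <= t -> 0 <= phi t;
  comparison_nondecreasing :
    forall s t, 0 <= s -> s <= t -> phi s <= phi t;
  comparison_right_usc : forall t, 0 <= t ->
    (limf_esup (EFin \o phi) t^'+ <= (phi t)%:E)%E;
  comparison0 : phi 0 = 0;
  comparison_lt : forall t, 0 < t -> phi t < t
}.

Definition Boyd_Wong_contraction (R : realType) (X A : Type)
    (d : A -> X -> X -> R) (T : X -> X) : Prop :=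
  exists phi : A -> R -> R,
    (forall a, comparison_function (phi a)) /\
    forall a x y, d a (T x) (T y) <= phi a (d a x y) /\
                  d a (T y) (T x) <= phi a (d a y x).

(* Main.v *)
Require Import Defs.
From mathcomp Require Import all_boot all_order all_algebra.
From mathcomp Require Import all_classical all_reals all_analysis.
From mathcomp Require Import lra.
Import Order.TTheory GRing.Theory Num.Theory.
Import numFieldNormedType.Exports.
Local Open Scope classical_set_scope.
Local Open Scope ring_scope.
Set Implicit Arguments.
Unset Strict Implicit.
Unset Printing Implicit Defensive.

(** Fix a generating quasi-pseudometric [d] with comparison function [phi].
    Right upper semicontinuity forces any sequence [0 <= u (n+1) <= phi (u n)]
    to tend to [0], so consecutive iterates are eventually closer than
    [e - phi e]; then [d x_n x_m < e] propagates from [m] to [m + 1], because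
    [d x_n x_(m+1) <= d x_n x_(n+1) + phi (d x_n x_m) < (e - phi e) + phi e].
    The same argument for [fun x y => d y x] gives the other direction, so the
    orbit is Cauchy in the symmetrisation.  Its limit is at distance [0] from
    its image, in both directions, for every member of the family, hence is
    fixed by [T0]. *)

Section comparison.
Context {R : realType} {phi : R -> R} (Hphi : comparison_function phi).

Lemma comparison_le t : 0 <= t -> phi t <= t.
Proof.
rewrite le_eqVlt => /predU1P[<-|t0]; first by rewrite (comparison0 Hphi).
exact/ltW/(comparison_lt Hphi).
Qed.

Lemma comparison_le_eq0 t : 0 <= t -> t <= phi t -> t = 0.
Proof.
rewrite le_eqVlt => /predU1P[<-//|t0 tphi].
by have := lt_le_trans (comparison_lt Hphi t0) tphi; rewrite ltxx.
Qed.

(** The upper limit of [phi] at [t] from the right is at most [phi t < t], so [phi] stays below [t]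
    on some right neighbourhood of [t]. *)
Lemma comparison_lt_right t : 0 < t -> exists2 s, t < s & phi s < t.
Proof.
move=> t0; have : (limf_esup (EFin \o phi) t^'+ < t%:E)%E.
  apply: le_lt_trans (comparison_right_usc Hphi (ltW t0)) _.
  by rewrite lte_fin (comparison_lt Hphi).
move=> /ereal_inf_lt[_ [V tV <-] Vt].
have [s [ts Vs]] := filter_ex (filterI (nbhs_right_gt t) tV).
exists s => //; rewrite -lte_fin; apply: le_lt_trans Vt.
by apply: ereal_sup_ubound; exists s.
Qed.

Lemma comparison_cvg0 (u : R^nat) : (forall n, 0 <= u n) ->
  (forall n, u n.+1 <= phi (u n)) -> u @ \oo --> 0.
Proof.
move=> u0 uphi.
have u_decr : nonincreasing_seq u.
  apply/nonincreasing_seqP => n.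
  exact: le_trans (uphi n) (comparison_le (u0 n)).
have cu : cvgn u.
  by apply: nonincreasing_is_cvgn => //; exists 0 => _ [n _ <-].
have Lu := nonincreasing_cvgn_ge u_decr cu.
suff <- : limn u = 0 by [].
apply: contrapT => /eqP L0.
have {}L0 : 0 < limn u.
  by rewrite lt_neqAle eq_sym L0 limr_ge//; exact: nearW.
(* Once [u n < s], monotonicity gives [u n.+1 <= phi s < limn u], but a nonincreasing sequence never
   falls below its limit. *)
have [s Ls phis] := comparison_lt_right L0.
have [n un] : exists n, u n < s.
  exact: filter_ex (cvgr_lt _ cu _ Ls).
have := Lu n.+1; rewrite leNgt => /negP; apply.
apply: le_lt_trans (uphi n) _; apply: le_lt_trans phis.
exact: (comparison_nondecreasing Hphi) (u0 n) (ltW un).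
Qed.

End comparison.

Section orbits.
Context {R : realType} {X : Type} (d : X -> X -> R) (T : X -> X) (phi : R -> R).
Hypothesis d_qpm : quasi_pseudometric d.
Hypothesis Hphi : comparison_function phi.
Hypothesis T_contr : forall x y, d (T x) (T y) <= phi (d x y).

Lemma quasi_pseudometric_flip : quasi_pseudometric (fun x y => d y x).
Proof. by have [d0 dxx dD] := d_qpm; split=> // x y z; rewrite addrC. Qed.

Lemma fixpoint_dist0 x y : T x = x -> T y = y -> d x y = 0.
Proof.
have [d0 _ _] := d_qpm; move=> Tx Ty.
by apply: (comparison_le_eq0 Hphi) (d0 _ _) _; rewrite -{1}Tx -{1}Ty.
Qed.

(** Serves twice: [y := T x] controls consecutive iterates, and a fixed point as one starting point
    gives convergence of every orbit. *)
Lemma iter_dist_near x y (e : R) : 0 < e ->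
  \forall n \near \oo, d (iter n T x) (iter n T y) < e.
Proof.
have [d0 _ _] := d_qpm; move=> e0.
pose u n := d (iter n T x) (iter n T y).
have : u @ \oo --> 0.
  by apply: (comparison_cvg0 Hphi) => n; [exact: d0 | rewrite /u /= T_contr].
by move=> /cvgr_lt; exact.
Qed.

Lemma iter_dist_lt x (e : R) : 0 < e ->
  exists N, forall n m, (N <= n)%N -> (n <= m)%N ->
    d (iter n T x) (iter m T x) < e.
Proof.
have [d0 dxx dD] := d_qpm; move=> e0.
have phie := comparison_lt Hphi e0.
have gap : 0 < e - phi e by rewrite subr_gt0.
have [N _ HN] := iter_dist_near x (T x) gap; exists N => n m Nn.
elim: m => [|m IHm]; first by rewrite leqn0 => /eqP->; rewrite dxx.
rewrite leq_eqVlt => /predU1P[->|]; first by rewrite dxx.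
rewrite ltnS => /IHm {}IHm.
have := HN n Nn; rewrite /= -iterSr => step.
have := dD (iter n T x) (iter n.+1 T x) (iter m.+1 T x).
have := T_contr (iter n T x) (iter m T x).
have := comparison_nondecreasing Hphi (d0 _ _) (ltW IHm).
by rewrite /= in step *; lra.
Qed.

(** With [x_n] the iterates, [d p (T p) <= d p x_(N+1) + d (T x_N) (T p)], and the last term is at
    most [d x_N p] since [phi t <= t]; both terms can be made less than half of [d p (T p)]. *)
Lemma orbit_limit_dist0 x p :
  (forall e : R, 0 < e -> \forall n \near \oo,
     d p (iter n T x) < e /\ d (iter n T x) p < e) ->
  d p (T p) = 0.
Proof.
have [d0 dxx dD] := d_qpm; move=> xp.
apply/eqP; rewrite eq_le d0 andbT leNgt; apply/negP => pos.
have e0 : 0 < d p (T p) / 2 by rewrite divr_gt0.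
have [N _ HN] := xp _ e0.
have [_ h1] := HN N (leqnn N); have [h2 _] := HN N.+1 (leqnSn N).
have := dD p (iter N.+1 T x) (T p).
have := le_trans (T_contr (iter N T x) p) (comparison_le Hphi (d0 _ _)).
by rewrite /= in h1 h2 *; lra.
Qed.

End orbits.

Section generated.
Context {R : realType} {X A : Type} {U : quasiUniformity X}.
Context {d : A -> X -> X -> R} (U_gen : generated_by U d).

Lemma generated_subbase a (e : R) : 0 < e ->
  qentourage U [set xy | d a xy.1 xy.2 < e].
Proof.
move=> e0; rewrite U_gen; exists [set xy | d a xy.1 xy.2 < e] => //.
by apply: (@finI_from1 _ _ _ id); exists a, e.
Qed.

(** Minimality of the generated filter: a property of entourages need only be checked on the subbase
    once it is phrased as membership in a filter [G]. *)
Lemma generated_sub_filter (G : set_system (X * X)) : Filter G ->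
  (forall a (e : R), 0 < e -> G [set xy | d a xy.1 xy.2 < e]) ->
  qentourage U `<=` G.
Proof.
move=> FG dG V; rewrite U_gen => -[_ [D sD <-] DV].
apply: filterS DV _; apply: filter_bigI => W WD.
by have /set_mem[a [e [e0 ->]]] := sD _ WD; exact: dG.
Qed.

Lemma symmetrised_sub_filter (G : set_system (X * X)) : Filter G ->
  (forall a (e : R), 0 < e ->
    G [set xy | d a xy.1 xy.2 < e /\ d a xy.2 xy.1 < e]) ->
  symm_entourage U `<=` G.
Proof.
move=> FG dG V [W UW WV]; apply: (filterS WV).
pose swap (xy : X * X) := (xy.2, xy.1).
(* The preimage under [swap] is the inverse relation; the sets [W] whose symmetrisation lies in [G]
   again form a filter, so the subbase suffices. *)
suff sub : qentourage U `<=` [set W | G (W `&` swap @^-1` W)].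
  exact: sub W UW.
apply: generated_sub_filter => [|a e]; last exact: dG.
constructor=> [|P Q GP GQ|P Q PQ GP] /=.
- by rewrite preimage_setT setTI; exact: filterT.
- by apply: (filterS _ (@filterI _ G _ _ _ GP GQ)) => xy [[? ?] [? ?]].
- by apply: (@filterS _ G _ _ _ _ GP) => xy [? ?]; split; exact: PQ.
Qed.

Lemma symmetrised_cvgP (F : set_system X) (FF : Filter F) (p : X) :
  (F : set_system (symmetrised U)) --> (p : symmetrised U) <->
  forall a (e : R), 0 < e -> \forall y \near F, d a p y < e /\ d a y p < e.
Proof.
rewrite cvg_entourageP; split=> [Fp a e e0|Fp V UV].
  apply: (Fp [set xy | d a xy.1 xy.2 < e /\ d a xy.2 xy.1 < e]).
  by exists [set xy | d a xy.1 xy.2 < e]; first exact: generated_subbase.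
(* The image of [F] under [y |-> (p, y)]. *)
pose G := [set W : set (X * X) | \forall y \near F, W (p, y)].
have FG : Filter G by exact: (@fmap_filter _ _ (pair p) F FF).
by apply: (@symmetrised_sub_filter G).
Qed.

Lemma symmetrised_cauchy_seq (x : nat -> X) :
  (forall a (e : R), 0 < e -> exists N, forall n m, (N <= n)%N -> (N <= m)%N ->
     d a (x n) (x m) < e) ->
  cauchy ((x : nat -> symmetrised U) @ \oo).
Proof.
move=> xC V.
apply: (@symmetrised_sub_filter (filter_prod (x @ \oo) (x @ \oo))).
move=> a e /(xC a)[N HN].
have Ninf : \forall n \near \oo, (N <= n)%N by exact: nbhs_infty_ge.
(* The square of the tail from [N] is the required member of the product filter. *)
exists ([set y | exists2 n, (N <= n)%N & x n = y],
        [set y | exists2 n, (N <= n)%N & x n = y]).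
  by split; apply: filterS Ninf => n; exists n.
by move=> [_ _] /= [[n Nn <-] [m Nm <-]]; split; exact: HN.
Qed.

Lemma generated_T0_eq (U_T0 : qu_T0 U) x y :
  (forall a, d a x y = 0) -> (forall a, d a y x = 0) -> x = y.
Proof.
have in_bigcap z w : (forall a, d a z w = 0) ->
    (\bigcap_(V in qentourage U) V) (z, w).
  (* The sets containing the point [(z, w)] form a filter, and vanishing distances put the whole
     subbase in it. *)
  move=> zw V; apply: (@generated_sub_filter [set V | V (z, w)]).
    by constructor=> [|P Q ? ?|P Q PQ] //; exact: PQ.
  by move=> a e e0 /=; rewrite zw.
by move=> xy yx; apply: U_T0; exact: in_bigcap.
Qed.

End generated.

Lemma tails_leq : tails (fun m n : nat => (m <= n)%N) = \oo.
Proof. by apply/seteqP; split=> P [N]; exists N. Qed.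

(** A sequence is a net over [nat] directed by [<=]. *)
Lemma bicomplete_cauchy_seq {X : Type} {U : quasiUniformity X}
    (x : nat -> symmetrised U) :
  bicomplete U -> cauchy (x @ \oo) ->
  exists p : symmetrised U, x @ \oo --> p.
Proof.
move=> bU; rewrite -tails_leq; apply: bU; split=> [|i|i j k|i j].
- exact: (inhabits 0%N).
- exact: leqnn.
- exact: leq_trans.
- by exists (maxn i j); rewrite ?leq_maxl ?leq_maxr.
Qed.

Theorem theorem4p14 (R : realType) (X : Type) (X_nonempty : [set: X] !=set0)
  (U : quasiUniformity X) (U_T0 : qu_T0 U) (U_bicomplete : bicomplete U)
  (A : Type) (d : A -> X -> X -> R)
  (d_qpm : forall a, quasi_pseudometric (d a)) (U_gen : generated_by U d)
  (T : X -> X) (T_contr : Boyd_Wong_contraction d T) :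
  exists xstar : X,
    unique (fun x => T x = x) xstar /\
    forall x0 : X,
      (fun n : nat => iter n T x0 : symmetrised U) @ \oo -->
      (xstar : symmetrised U).
Proof.
case: T_contr => phi [Hphi dphi].
have dT a x y : d a (T x) (T y) <= phi a (d a x y) by have [] := dphi a x y.
have dT' a x y : d a (T y) (T x) <= phi a (d a y x) by exact: dT.
have flip_qpm a := quasi_pseudometric_flip (d_qpm a).
have [x0 _] := X_nonempty.
have [p xp] : exists p : symmetrised U,
    (fun n => iter n T x0 : symmetrised U) @ \oo --> p.
  apply: bicomplete_cauchy_seq => //.
  apply: (symmetrised_cauchy_seq U_gen) => a e e0.
  have [N1 H1] := iter_dist_lt (d_qpm a) (Hphi a) (dT a) x0 e0.
  have [N2 H2] := iter_dist_lt (flip_qpm a) (Hphi a) (dT' a) x0 e0.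
  exists (maxn N1 N2) => n m; rewrite !geq_max => /andP[n1 n2] /andP[m1 m2].
  (* If [m < n], the distance from [x_n] to [x_m] is the flipped distance from the earlier iterate
     to the later one. *)
  by have [nm|/ltnW mn] := leqP n m; [exact: H1 | exact: H2].
move/(symmetrised_cvgP U_gen) in xp.
have Tp : T p = p.
  apply: (generated_T0_eq U_gen U_T0) => a.
    apply: (orbit_limit_dist0 (flip_qpm a) (Hphi a) (dT' a) (x := x0)) => e e0.
    by have [N _ HN] := xp a e e0; exists N => // n /HN[].
  apply: (orbit_limit_dist0 (d_qpm a) (Hphi a) (dT a) (x := x0)) => e e0.
  exact: xp.
exists p; split.
  split=> // y Ty; apply: (generated_T0_eq U_gen U_T0) => a;
    exact: (fixpoint_dist0 (d_qpm a) (Hphi a) (dT a)).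
move=> x; apply/(symmetrised_cvgP U_gen) => a e e0.
(* The orbit of [p] is constant, so comparing it with the orbit of [x] in both orders bounds both
   distances between [p] and the iterates of [x]. *)
have iterp n : iter n T p = p by exact: iter_fix.
have near1 := iter_dist_near (d_qpm a) (Hphi a) (dT a) p x e0.
have near2 := iter_dist_near (d_qpm a) (Hphi a) (dT a) x p e0.
by apply: (filterS _ (filterI near1 near2)) => n []; rewrite !iterp.
Qed.
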